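(* For any integer $n\ge 1$, the complete graph $K_n$ is a shortest path graph.
   Context: Graphs are finite and simple. For a graph $G$ with distinct vertices $a,b$, a shortest $a,b$-path is a path between $a$ and $b$ of length $d_G(a,b)$. The shortest path graph $S(G,a,b)$ is the graph whose vertices are the shortest $a,b$-paths in $G$, two of them being adjacent if and only if the corresponding paths differ in exactly one vertex. A graph $H$ is called a shortest path graph if there exist a graph $G$ and distinct $a,b\in V(G)$ with $S(G,a,b)\cong H$. *)

(* Defs.v *)
From mathcomp Require Import all_boot.

Set Implicit Arguments.
Unset Strict Implicit.
Unset Printing Implicit Defensive.

Record sgraph := SGraph {
  vertex :> finType;
  edge : rel vertex;
  edge_sym : symmetric edge;
  edge_irr : irreflexive edge }.

(* A path between [a] and [b] is encoded by its sequence of vertices listed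
   from [a] to [b]; for [a != b] this encoding is one-to-one, and the length of
   the path [s] is [(size s).-1]. *)
Definition is_path (G : sgraph) (a b : G) (s : seq G) : bool :=
  if s is x :: p then [&& x == a, last x p == b, path (@edge G) x p & uniq s]
  else false.

(* No path has length [#|G|] or more, so the value [#|G|] stands for an
   infinite distance. *)
Definition dist (G : sgraph) (a b : G) : nat :=
  \big[minn/#|G|]_(k < #|G| | [exists s : k.+1.-tuple G, is_path a b s]) k.

Definition shortest_path (G : sgraph) (a b : G) : finType :=
  {s : (dist a b).+1.-tuple G | is_path a b s}.

(* All shortest paths between [a] and [b] have the same number of vertices and
   the [i]-th vertex of each is at distance [i] from [a], so they are compared
   position by position. *)
Definition differ_in_one (G : sgraph) (a b : G) : rel (shortest_path a b) :=
  fun p q => #|[set i | tnth (val p) i != tnth (val q) i]| == 1.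

Lemma differ_in_one_sym (G : sgraph) (a b : G) :
  symmetric (@differ_in_one G a b).
Proof.
move=> p q; rewrite /differ_in_one; congr (_ == 1).
by apply: eq_card => i; rewrite !inE eq_sym.
Qed.

Lemma differ_in_one_irr (G : sgraph) (a b : G) :
  irreflexive (@differ_in_one G a b).
Proof.
move=> p; rewrite /differ_in_one (_ : [set i | _] = set0) ?cards0 //.
by apply/setP=> i; rewrite !inE eqxx.
Qed.

Definition shortest_paths_graph (G : sgraph) (a b : G) : sgraph :=
  SGraph (@differ_in_one_sym G a b) (@differ_in_one_irr G a b).

Definition graph_iso (G H : sgraph) : Prop :=
  exists f : G -> H, bijective f /\ forall x y, edge (f x) (f y) = edge x y.

Definition is_shortest_path_graph (H : sgraph) : Prop :=
  exists (G : sgraph) (a b : G), a != b /\ graph_iso (shortest_paths_graph a b) H.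

Definition complete_rel (n : nat) : rel 'I_n := fun x y => x != y.

Lemma complete_rel_sym (n : nat) : symmetric (@complete_rel n).
Proof. by move=> x y; rewrite /complete_rel eq_sym. Qed.

Lemma complete_rel_irr (n : nat) : irreflexive (@complete_rel n).
Proof. by move=> x; rewrite /complete_rel eqxx. Qed.

Definition complete_graph (n : nat) : sgraph :=
  SGraph (@complete_rel_sym n) (@complete_rel_irr n).

(* Main.v *)
(* In the complete bipartite graph K_{2,n}, take for [a] and [b] the two
   vertices of the side of size 2.  They are not adjacent, and their shortest
   paths are the [a, i, b] with [i] on the side of size [n]; any two of these
   differ in the middle vertex only. *)
Require Import Defs.
From mathcomp Require Import all_boot.

Lemma bigminn_le_seq (I : eqType) (r : seq I) (P : pred I) (F : I -> nat)
    (m : nat) {i : I} :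
  i \in r -> P i -> \big[minn/m]_(j <- r | P j) F j <= F i.
Proof.
elim: r => // j r IHr; rewrite inE big_cons => /orP[/eqP<- -> | ri Pi].
  exact: geq_minl.
by case: ifP => _; rewrite ?(leq_trans (geq_minr _ _)) ?IHr.
Qed.

Lemma dist_le {G : sgraph} {a b : G} {s : seq G} :
  is_path a b s -> dist a b <= (size s).-1.
Proof.
case: s => // x p path_p; have /and4P[_ _ _ us] := path_p.
(* The vertices of a path are distinct, so its length falls in the index range of the minimum. *)
have lt_p : size p < #|G|.
  by rewrite -[(size p).+1]/(size (x :: p)) -(card_uniqP us) max_card.
apply: (@bigminn_le_seq _ _ _ _ _ (Ordinal lt_p)); first exact: mem_index_enum.
by apply/existsP; exists (in_tuple (x :: p)).
Qed.

(** The first hypothesis covers the default value [#|G|] of the minimum. *)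
Lemma dist_ge {G : sgraph} {a b : G} {m : nat} :
  m <= #|G| -> (forall s, is_path a b s -> m <= (size s).-1) -> m <= dist a b.
Proof.
move=> le_mG le_m; apply: (big_ind (leq m)) => // [x y mx my | k].
  by rewrite leq_min mx.
by case/existsP=> s /le_m; rewrite size_tuple.
Qed.

(** Adjacency of K_{2,n}: the summands are its two sides. *)
Definition K2_rel {n : nat} : rel (bool + 'I_n) :=
  fun x y => (if x is inl _ then true else false)
             != (if y is inl _ then true else false).

Lemma K2_rel_sym (n : nat) : symmetric (@K2_rel n).
Proof. by move=> x y; rewrite /K2_rel eq_sym. Qed.

Lemma K2_rel_irr (n : nat) : irreflexive (@K2_rel n).
Proof. by move=> x; rewrite /K2_rel eqxx. Qed.

Definition K2_graph (n : nat) : sgraph :=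
  SGraph (K2_rel_sym n) (K2_rel_irr n).

Definition K2_src (n : nat) : K2_graph n := inl false.
Definition K2_dst (n : nat) : K2_graph n := inl true.

Definition K2_walk {n : nat} (i : 'I_n) : seq (K2_graph n) :=
  [:: K2_src n; inr i; K2_dst n].

Lemma K2_walk_path {n : nat} (i : 'I_n) :
  is_path (K2_src n) (K2_dst n) (K2_walk i).
Proof. by []. Qed.

Lemma dist_K2 {n : nat} : 0 < n -> dist (K2_src n) (K2_dst n) = 2.
Proof.
move=> n_gt0; apply/eqP; rewrite eqn_leq.
rewrite (dist_le (K2_walk_path (Ordinal n_gt0))) /=.
(* A single vertex would identify the endpoints; two would make an edge inside one side. *)
apply: dist_ge => [|[|x [|y [|z p]]] //=].
- by rewrite card_sum card_bool leq_addr.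
- by case/andP=> /eqP->.
- by case/and3P=> /eqP-> /eqP->.
Qed.

Lemma K2_path3 {n : nat} {s : seq (K2_graph n)} :
  is_path (K2_src n) (K2_dst n) s -> size s = 3 -> exists i, s = K2_walk i.
Proof.
case: s => [|x [|y [|z [|t p]]]] //=.
case/and4P=> /eqP-> /eqP-> pp _ _.
(* Being adjacent to [K2_src n], the middle vertex cannot be an [inl]. *)
by case: y pp => [c|i] //= _; exists i.
Qed.

Theorem lemma5 (n : nat) (hn : 1 <= n) :
  is_shortest_path_graph (complete_graph n).
Proof.
exists (K2_graph n), (K2_src n), (K2_dst n); split=> //.
set S := shortest_paths_graph _ _.
have dist2 := dist_K2 hn.
have walkE (p : S) : exists i, val (val p) = K2_walk i.
  by apply: K2_path3 (valP p) _; rewrite size_tuple dist2.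
have size_walk (i : 'I_n) : size (K2_walk i) == (dist (K2_src n) (K2_dst n)).+1.
  by rewrite dist2.
pose g (i : 'I_n) : S :=
  Sub (Tuple (size_walk i)) (K2_walk_path i).
(* Position 1 holds the middle vertex. By [walkE] it is always an [inr], so the value [Ordinal hn]
   is never taken. *)
pose f (p : S) : 'I_n :=
  if nth (K2_src n) (val (val p)) 1 is inr i then i else Ordinal hn.
have gK : cancel g f by [].
have fK : cancel f g.
  move=> p; have [i Ep] := walkE p.
  by apply: val_inj; apply: val_inj; rewrite /f /= Ep.
exists f; split; first by exists g.
(* Both paths become values of [g], hence explicit walks to compare entrywise. *)
move=> x y; rewrite -[x]fK -[y]fK !gK.
move: (f x) (f y) => i j /=; rewrite /complete_rel /differ_in_one.
have [-> | neq_ij] := eqVneq i j.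
  rewrite (_ : [set k | _] = set0) ?cards0 //.
  by apply/setP=> k; rewrite !inE eqxx.
(* The middle position has to be an ordinal below [dist] plus one, a bound known to be 3 only
   through [dist2]. *)
have lt1 : 1 < (dist (K2_src n) (K2_dst n)).+1 by rewrite dist2.
rewrite (_ : [set k | _] = [set Ordinal lt1]) ?cards1 //.
apply/setP=> k; rewrite !inE !(tnth_nth (K2_src n)) -val_eqE /=.
have : k < 3 by rewrite -dist2.
by case: (val k) => [|[|[|]]].
Qed.
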